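(* Let $K\subset\mathbb{R}^3$ be a centrally symmetric convex body (i.e. a compact convex set with $K=-K$) such that $\mathrm{r}_2(K)>0$. Then \[ \frac{\mathrm{R}_2(K)}{\mathrm{r}_2(K)}\leq \frac{2\sqrt{2}}{\sqrt{3}}. \]
   Context: A convex body is a compact convex subset of $\mathbb{R}^n$. For $1\le i\le n$, let $\mathcal{L}^n_i$ be the set of $i$-dimensional linear subspaces of $\mathbb{R}^n$, $K|L$ the orthogonal projection of $K$ onto $L$, $L^\perp$ the orthogonal complement. For a set $C$ contained in an affine subspace $A$, $\mathrm{R}(C;A)$ and $\mathrm{r}(C;A)$ denote the Euclidean circumradius and inradius of $C$ measured within $A$. Define $\mathrm{R}_i(K)=\min_{L\in\mathcal{L}^n_i}\mathrm{R}(K|L;L)$ (the smallest radius of a solid cylinder with $i$-dimensional spherical cross-section containing $K$) and $\mathrm{r}_i(K)=\max_{L\in\mathcal{L}^n_i}\max_{x\in L^\perp}\mathrm{r}(K\cap(x+L);x+L)$ (the largest radius of an $i$-dimensional Euclidean disc contained in $K$). *)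

(* Defs.v *)
From HB Require Import structures.
From mathcomp Require Import all_boot all_order all_algebra.
From mathcomp Require Import all_classical all_reals all_analysis.
Set Implicit Arguments. Unset Strict Implicit. Unset Printing Implicit Defensive.
Import Order.TTheory GRing.Theory Num.Theory numFieldNormedType.Exports.
Local Open Scope classical_set_scope.
Local Open Scope ring_scope.

Section Geom.
Variable R : realType.
Notation vec := 'rV[R]_3.

Definition dot (u v : vec) : R := \sum_(i < 3) u ord0 i * v ord0 i.
Definition enorm (u : vec) : R := Num.sqrt (dot u u).

(* (u, v) orthonormal: an orthonormal basis of the 2-dim linear subspace span2 u v;
   every L in L^3_2 is of this form. *)
Definition orthonormal2 (u v : vec) : Prop :=
  dot u u = 1 /\ dot v v = 1 /\ dot u v = 0.
Definition span2 (u v : vec) : set vec := [set a *: u + b *: v | a in setT & b in setT].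
Definition proj2 (u v : vec) (p : vec) : vec := dot p u *: u + dot p v *: v.
Definition translate (x : vec) (A : set vec) : set vec := [set x + y | y in A].

Definition circumradius (C A : set vec) : R :=
  inf [set r : R | exists2 c, A c & forall y, C y -> enorm (y - c) <= r].
Definition inradius (C A : set vec) : R :=
  sup [set r : R | 0 <= r /\ exists2 c, A c &
         forall y, A y -> enorm (y - c) <= r -> C y].

Definition R2 (K : set vec) : R :=
  inf [set rr : R | exists u v, orthonormal2 u v /\
         rr = circumradius (proj2 u v @` K) (span2 u v)].
Definition r2 (K : set vec) : R :=
  sup [set rr : R | exists u v x, orthonormal2 u v /\ dot x u = 0 /\ dot x v = 0 /\
         rr = inradius (K `&` translate x (span2 u v)) (translate x (span2 u v))].

Definition convex_set (K : set vec) : Prop :=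
  forall x y t, K x -> K y -> 0 <= t -> t <= 1 -> K (t *: x + (1 - t) *: y).

Definition convex_body (K : set vec) : Prop := compact K /\ convex_set K.
Definition centrally_symmetric (K : set vec) : Prop := [set - x | x in K] = K.
End Geom.

(* Main.v *)
(* Let [p] be a point of [K] of maximal norm. If [q] in [K] is orthogonal to [p],
   the rhombus with diagonals [p], [q] contains a disc of radius [|q| / sqrt 2],
   so [K] meets [p^perp] inside the disc of radius [s = sqrt 2 * r2 K]. It remains
   to find a cylinder of radius [2 s / sqrt 3] containing [K]; its axis [w] is
   chosen so that the largest length [g] of a point of [K] projected onto [p^perp]
   along [w] is minimal. Let [v], [v'] be two projected points of length [g],
   coming from points of [K] at heights [z, z' > 0] above [p^perp]. The segment
   from the first to the opposite of the second crosses [p^perp] inside [K], hence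
   [|z' v - z v'| <= s (z + z')], which gives [<v, v'> >= g^2 - 2 s^2]. If
   [g > 2 s / sqrt 3], all these vectors make angles smaller than 120 degrees
   with one another, so in the plane [p^perp] they lie in an open half-plane,
   and tilting [w] in that direction decreases [g]: a contradiction. *)
Require Import Defs.
From HB Require Import structures.
From mathcomp Require Import all_boot all_order all_algebra.
From mathcomp Require Import all_classical all_reals all_analysis.
From mathcomp Require Import ring lra.
Set Implicit Arguments. Unset Strict Implicit. Unset Printing Implicit Defensive.
Import Order.TTheory GRing.Theory Num.Theory numFieldNormedType.Exports.
Local Open Scope classical_set_scope.
Local Open Scope ring_scope.

(** * Coordinate algebra of the inner product on three-space *)

Section EuclideanSpace.
Variable R : realType.
Implicit Types (u v w x y p q : 'rV[R]_3) (a b c t : R).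

Definition vec3 a b c : 'rV[R]_3 := \row_(i < 3) [:: a; b; c]`_i.

Lemma dotE u v :
  dot u v = u 0 0 * v 0 0 + u 0 1 * v 0 1 + u 0 2%:R * v 0 2%:R.
Proof.
rewrite /dot !big_ord_recl big_ord0 addr0 addrA.
by congr (_ + _ * _ + _ * _); congr (_ _ _); apply: val_inj.
Qed.

Lemma dot_vec3 u a b c :
  dot u (vec3 a b c) = u 0 0 * a + u 0 1 * b + u 0 2%:R * c.
Proof. by rewrite dotE !mxE. Qed.

Lemma dotC u v : dot u v = dot v u.
Proof. by rewrite !dotE; ring. Qed.

Lemma dotDl u v w : dot (u + v) w = dot u w + dot v w.
Proof. by rewrite !dotE !mxE; ring. Qed.

Lemma dotZl a u v : dot (a *: u) v = a * dot u v.
Proof. by rewrite !dotE !mxE; ring. Qed.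

Lemma dotNl u v : dot (- u) v = - dot u v.
Proof. by rewrite !dotE !mxE; ring. Qed.

Lemma dotDr u v w : dot w (u + v) = dot w u + dot w v.
Proof. by rewrite !dotE !mxE; ring. Qed.

Lemma dotZr a u v : dot v (a *: u) = a * dot v u.
Proof. by rewrite !dotE !mxE; ring. Qed.

Lemma dotNr u v : dot v (- u) = - dot v u.
Proof. by rewrite !dotE !mxE; ring. Qed.

Definition dot_linear := (dotDl, dotDr, dotZl, dotZr, dotNl, dotNr).

Lemma dot_ge0 u : 0 <= dot u u.
Proof. by rewrite dotE; nra. Qed.

Lemma dot_gt0 u : u != 0 -> 0 < dot u u.
Proof.
move=> u0; rewrite lt_neqAle dot_ge0 andbT eq_sym; apply: contra_neq u0.
rewrite dotE => h; apply/rowP => i; rewrite !mxE.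
have : u 0 0 = 0 /\ u 0 1 = 0 /\ u 0 2%:R = 0 by nra.
case=> h0 [h1 h2]; case: i => -[|[|[|//]]] ilt.
- by rewrite -[RHS]h0; congr (u _ _); apply: val_inj.
- by rewrite -[RHS]h1; congr (u _ _); apply: val_inj.
- by rewrite -[RHS]h2; congr (u _ _); apply: val_inj.
Qed.

Lemma enorm_le u c : 0 <= c -> (enorm u <= c) = (dot u u <= c ^+ 2).
Proof.
by move=> c0; rewrite /enorm -{1}(ger0_norm c0) -sqrtr_sqr ler_sqrt ?sqr_ge0.
Qed.

Lemma bessel u v w : orthonormal2 u v ->
  dot w u ^+ 2 + dot w v ^+ 2 <= dot w w.
Proof.
move=> [uu [vv uv]]; have := dot_ge0 (w - dot w u *: u - dot w v *: v).
rewrite !dot_linear uu vv (dotC u w) (dotC v w) (dotC v u) uv; lra.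
Qed.

Lemma dot_proj2 u v w : orthonormal2 u v ->
  dot (proj2 u v w) (proj2 u v w) = dot w u ^+ 2 + dot w v ^+ 2.
Proof.
move=> [uu [vv uv]]; rewrite /proj2 !dot_linear uu vv (dotC v u) uv; ring.
Qed.

Lemma normalize u : u != 0 ->
  dot ((Num.sqrt (dot u u))^-1 *: u) ((Num.sqrt (dot u u))^-1 *: u) = 1.
Proof.
move=> /dot_gt0 u0; rewrite !dot_linear mulrA -expr2 exprVn sqr_sqrtr ?ltW//.
by rewrite mulVf ?gt_eqF.
Qed.

Lemma orthonormal_complement w : w != 0 ->
  exists u v, [/\ orthonormal2 u v, dot w u = 0 & dot w v = 0].
Proof.
move=> w0.
have [u u0 wu] : exists2 u, u != 0 & dot w u = 0.
  have [/eqP h|h] := boolP (vec3 (- w 0 1) (w 0 0) 0 == 0).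
    have h0 : w 0 0 = 0 by have /rowP/(_ 1) := h; rewrite !mxE.
    exists (vec3 1 0 0); last by rewrite dot_vec3 h0; ring.
    by apply/eqP => /rowP/(_ 0); rewrite !mxE; apply/eqP; rewrite oner_eq0.
  by exists (vec3 (- w 0 1) (w 0 0) 0) => //; rewrite dot_vec3; ring.
(* [v] is the cross product of [w] and [u]; [vv] below is Lagrange's identity, which shows that [v]
   is nonzero. *)
pose v := vec3 (w 0 1 * u 0 2%:R - w 0 2%:R * u 0 1)
   (w 0 2%:R * u 0 0 - w 0 0 * u 0 2%:R) (w 0 0 * u 0 1 - w 0 1 * u 0 0).
have wv : dot w v = 0 by rewrite dot_vec3; ring.
have uv : dot u v = 0 by rewrite dot_vec3; ring.
have vv : dot v v = dot w w * dot u u - dot w u ^+ 2.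
  by rewrite !dotE !mxE /=; ring.
have v0 : v != 0.
  apply/eqP => v0; move: vv; rewrite v0 wu expr0n /= subr0.
  rewrite {1}/dot big1 => [/esym/eqP|i _]; last by rewrite mxE mul0r.
  by rewrite mulf_eq0 !gt_eqF ?dot_gt0.
exists ((Num.sqrt (dot u u))^-1 *: u), ((Num.sqrt (dot v v))^-1 *: v); split.
- by split; [exact: normalize|split; [exact: normalize|]];
    rewrite !dot_linear uv !mulr0.
- by rewrite dotZr wu mulr0.
- by rewrite dotZr wv mulr0.
Qed.

(* Linear independence fails in the plane [p^perp], so the Gram determinant of
   three of its vectors vanishes. *)
Lemma gram3_eq0 p x y w : p != 0 ->
  dot x p = 0 -> dot y p = 0 -> dot w p = 0 ->
  dot x x * dot y y * dot w w + 2 * (dot x y * dot x w * dot y w)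
  - dot x x * dot y w ^+ 2 - dot y y * dot x w ^+ 2
  - dot w w * dot x y ^+ 2 = 0.
Proof.
move=> /dot_gt0 p0 xp yp wp.
pose D := x 0 0 * (y 0 1 * w 0 2%:R - y 0 2%:R * w 0 1)
        + x 0 1 * (y 0 2%:R * w 0 0 - y 0 0 * w 0 2%:R)
        + x 0 2%:R * (y 0 0 * w 0 1 - y 0 1 * w 0 0).
have -> : dot x x * dot y y * dot w w + 2 * (dot x y * dot x w * dot y w)
  - dot x x * dot y w ^+ 2 - dot y y * dot x w ^+ 2
  - dot w w * dot x y ^+ 2 = D ^+ 2.
  by rewrite !dotE /D; ring.
suff /eqP : D * dot p p = 0.
  by rewrite mulf_eq0 (gt_eqF p0) orbF => /eqP ->; rewrite expr0n.
(* [D] is the determinant of [x], [y], [w]. Cramer's identity writes [D *: p] through the cross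
   products of these vectors; here it is paired with [p]. *)
have -> : D * dot p p =
    dot x p * (p 0 0 * (y 0 1 * w 0 2%:R - y 0 2%:R * w 0 1)
             + p 0 1 * (y 0 2%:R * w 0 0 - y 0 0 * w 0 2%:R)
             + p 0 2%:R * (y 0 0 * w 0 1 - y 0 1 * w 0 0))
  + dot y p * (p 0 0 * (w 0 1 * x 0 2%:R - w 0 2%:R * x 0 1)
             + p 0 1 * (w 0 2%:R * x 0 0 - w 0 0 * x 0 2%:R)
             + p 0 2%:R * (w 0 0 * x 0 1 - w 0 1 * x 0 0))
  + dot w p * (p 0 0 * (x 0 1 * y 0 2%:R - x 0 2%:R * y 0 1)
             + p 0 1 * (x 0 2%:R * y 0 0 - x 0 0 * y 0 2%:R)
             + p 0 2%:R * (x 0 0 * y 0 1 - x 0 1 * y 0 0)).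
  by rewrite !dotE /D; ring.
by rewrite xp yp wp !mul0r !addr0.
Qed.

Lemma continuous_dot {T : topologicalType} (f g : T -> 'rV[R]_3) :
  continuous f -> continuous g -> continuous (fun z => dot (f z) (g z)).
Proof.
move=> cf cg t.
have cc (h : T -> 'rV[R]_3) (i : 'I_3) : continuous h ->
    {for t, continuous (fun z => h z 0 i)}.
  move=> ch; apply: (@continuous_comp _ _ _ h (fun M : 'rV[R]_3 => M 0 i) t).
    exact: ch.
  exact: coord_continuous.
have -> : (fun z => dot (f z) (g z)) = (fun z => f z 0 0 * g z 0 0
    + f z 0 1 * g z 0 1 + f z 0 2%:R * g z 0 2%:R).
  by apply/funext => z; rewrite dotE.
by apply: cvgD; [apply: cvgD|]; apply: cvgM; apply: cc.
Qed.

End EuclideanSpace.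

(** * Estimates for circumradii, inradii and central sections *)

Section Radii.
Variable R : realType.
Implicit Types (K : set 'rV[R]_3) (u v w x y p q c : 'rV[R]_3) (a b r s t : R).

(** The definition does not ask radii to be nonnegative; a point of [C] forces it. If no ball covers
    [C], the infimum is that of the empty set, which is [0]. *)
Lemma circumradius_ge0 (C A : set 'rV[R]_3) : C !=set0 -> 0 <= circumradius C A.
Proof.
move=> [y Cy]; rewrite /circumradius; set E := (X in inf X).
have [->|/set0P E0] := eqVneq E set0; first by rewrite inf0.
apply: lb_le_inf => // r [c _ /(_ y Cy)]; apply: le_trans; exact: sqrtr_ge0.
Qed.

Lemma circumradius_le (C A : set 'rV[R]_3) c r : C !=set0 ->
  A c -> (forall y, C y -> enorm (y - c) <= r) -> circumradius C A <= r.
Proof.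
move=> [y Cy] Ac Cr; apply: ge_inf; last by exists c.
by exists 0 => r' [c' _ /(_ y Cy)]; apply: le_trans; exact: sqrtr_ge0.
Qed.

(* An orthogonal projection along [w] is never longer than an oblique one. *)
Lemma R2_le_cylinder K w r : K !=set0 -> w != 0 -> 0 <= r ->
  (forall y, K y -> exists t, dot (y - t *: w) (y - t *: w) <= r ^+ 2) ->
  R2 K <= r.
Proof.
move=> K0 w0 r0 Kr; have [u [v [uv wu wv]]] := orthonormal_complement w0.
have im0 u' v' : proj2 u' v' @` K !=set0.
  by case: K0 => y Ky; exists (proj2 u' v' y), y.
apply: (@le_trans _ _ (circumradius (proj2 u v @` K) (span2 u v))).
  apply: ge_inf; last by exists u, v.
  by exists 0 => _ [u' [v' [_ ->]]]; exact: circumradius_ge0.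
apply: (@circumradius_le _ _ 0) => //.
  by exists 0 => //; exists 0 => //; rewrite !scale0r addr0.
move=> _ [y Ky <-]; rewrite subr0 enorm_le// dot_proj2//.
have [t] := Kr y Ky; apply: le_trans; have := bessel (y - t *: w) uv.
by rewrite !(dotDl, dotNl, dotZl) wu wv !mulr0 !subr0.
Qed.

Lemma inradius_le K A r : 0 <= r ->
  (forall c s, 0 <= s -> A c ->
     (forall y, A y -> enorm (y - c) <= s -> K y) -> s <= r) ->
  inradius K A <= r.
Proof.
move=> r0 h; rewrite /inradius; set E := (X in sup X).
have [->|/set0P E0] := eqVneq E set0; first by rewrite sup0.
by apply: ge_sup => // s [s0 [c Ac /h]]; exact.
Qed.

(** Parallelogram law for the ends [c + s u] and [c - s u] of a diameter: their squared norms
    average to [|c|^2 + s^2], and both are at most [r^2]. *)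
Lemma disc_radius_le K u v x c s r : orthonormal2 u v -> 0 <= r ->
  (forall y, K y -> dot y y <= r ^+ 2) -> 0 <= s ->
  translate x (span2 u v) c ->
  (forall y, translate x (span2 u v) y -> enorm (y - c) <= s ->
     (K `&` translate x (span2 u v)) y) -> s <= r.
Proof.
move=> [uu [vv uv]] r0 Kr s0 [_ [a _ [b _ <-]] <-] h.
pose e (t : R) := x + ((a + t) *: u + b *: v).
have Ke t : t ^+ 2 = s ^+ 2 -> dot (e t) (e t) <= r ^+ 2.
  move=> ts; apply: Kr; apply: (h (e t) _ _).1.
    by exists ((a + t) *: u + b *: v) => //; exists (a + t) => //; exists b.
  have -> : e t - (x + (a *: u + b *: v)) = t *: u.
    by apply/rowP => i; rewrite !mxE; ring.
  by rewrite enorm_le// !dot_linear uu mulr1 -expr2 ts.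
have h1 := Ke s erefl; have h2 := Ke (- s) (sqrrN _).
have h3 := dot_ge0 (x + (a *: u + b *: v)).
suff : s ^+ 2 <= r ^+ 2 by rewrite ler_sqr.
have e1 : dot (e s) (e s) + dot (e (- s)) (e (- s)) =
   2 * dot (x + (a *: u + b *: v)) (x + (a *: u + b *: v)) + 2 * s ^+ 2.
  rewrite /e !dot_linear uu; ring.
lra.
Qed.

Lemma farthest_point K : compact K -> K !=set0 ->
  exists2 p, K p & forall y, K y -> dot y y <= dot p p.
Proof.
move=> cK K0; have cdot : continuous (fun y : 'rV[R]_3 => dot y y).
  by apply: continuous_dot => y; exact: cvg_id.
have [p /[!inE] Kp pmax] := EVT_max_rV K0 cK (continuous_subspaceT cdot).
by exists p => // y Ky; apply: pmax; rewrite inE.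
Qed.

Lemma compact_dot_bounded K : compact K ->
  exists2 r, 0 <= r & forall y, K y -> dot y y <= r ^+ 2.
Proof.
move=> cK; have [->|/set0P K0] := eqVneq K set0; first by exists 0.
have [p _ pmax] := farthest_point cK K0.
exists (Num.sqrt (dot p p)) => [|y Ky]; first exact: sqrtr_ge0.
by rewrite sqr_sqrtr ?dot_ge0 ?pmax.
Qed.

(** An element lies below a supremum only if the set is bounded above; compactness ensures this for
    both nested suprema, through [disc_radius_le]. *)
Lemma disc_le_r2 K u v s : compact K -> orthonormal2 u v -> 0 <= s ->
  (forall y, span2 u v y -> enorm y <= s -> K y) -> s <= r2 K.
Proof.
move=> cK uv s0 h; have [r r0 Kr] := compact_dot_bounded cK.
have span0 : translate 0 (span2 u v) 0.
  exists 0; last by rewrite addr0.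
  by exists 0 => //; exists 0 => //; rewrite !scale0r addr0.
apply: (@le_trans _ _ (inradius (K `&` translate 0 (span2 u v))
                                (translate 0 (span2 u v)))).
  apply: ub_le_sup.
    by exists r => t [t0 [c Ac hc]]; exact: (disc_radius_le uv r0 Kr t0 Ac hc).
  split=> //; exists 0 => // y Ay; rewrite subr0 => ys; split=> //.
  by apply: h => //; case: Ay => y' Sy' <-; rewrite add0r.
apply: ub_le_sup.
  exists r => _ [u' [v' [x' [uv' [_ [_ ->]]]]]].
  by apply: inradius_le => // c t t0 Ac hc; exact: (disc_radius_le uv' r0 Kr t0 Ac hc).
exists u, v, 0; do !split => //; try exact: uv.1; try exact: uv.2.1;
  try exact: uv.2.2; by rewrite dotE !mxE !mul0r !addr0.
Qed.

Lemma r2_gt0_nonempty K : 0 < r2 K -> K !=set0.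
Proof.
move=> r0; apply/set0P/eqP => K0; move: r0; rewrite K0 ltNge => /negP; apply.
rewrite /r2; set E := (X in sup X).
have [->|/set0P E0] := eqVneq E set0; first by rewrite sup0.
apply: ge_sup => // _ [u [v [x [_ [_ [_ ->]]]]]].
apply: inradius_le => // c s s0 Ac h.
(* The centre of an admissible disc would belong to the empty set. *)
suff /(h c Ac)[] : enorm (c - c) <= s by [].
by rewrite enorm_le// subrr dotE !mxE !mul0r !addr0 sqr_ge0.
Qed.

Lemma symmetricN K y : centrally_symmetric K -> K y -> K (- y).
Proof. by move=> sK Ky; rewrite -sK; exists y. Qed.

Lemma symmetric_convex_scale K y t : Defs.convex_set K -> centrally_symmetric K ->
  K y -> 0 <= t -> t <= 1 -> K (t *: y).
Proof.
move=> vK sK Ky t0 t1.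
have K0 : K 0.
  have := vK y (- y) 2^-1 Ky (symmetricN sK Ky).
  have -> : 2^-1 *: y + (1 - 2^-1) *: - y = 0.
    by apply/rowP => i; rewrite !mxE; field.
  by apply; rewrite ?invr_ge0// invf_le1// ler1n.
by have := vK y 0 t Ky K0 t0 t1; rewrite scaler0 addr0.
Qed.

(** Passing to [- p] or [- q] makes both coefficients nonnegative; the point is then [a + b <= 1]
    times a point of the segment from [p] to [q]. *)
Lemma symmetric_convex_rhombus K p q a b : Defs.convex_set K ->
  centrally_symmetric K -> K p -> K q -> `|a| + `|b| <= 1 ->
  K (a *: p + b *: q).
Proof.
move=> vK sK.
wlog a0 : a p / 0 <= a.
  move=> h Kp Kq ab; have [a0|a0] := leP 0 a; first exact: h.
  have -> : a *: p = (- a) *: (- p) by rewrite scalerN scaleNr opprK.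
  apply: h => //; [by rewrite oppr_ge0 ltW|exact: symmetricN|by rewrite normrN].
wlog b0 : b q / 0 <= b.
  move=> h Kp Kq ab; have [b0|b0] := leP 0 b; first exact: h.
  have -> : b *: q = (- b) *: (- q) by rewrite scalerN scaleNr opprK.
  apply: h => //; [by rewrite oppr_ge0 ltW|exact: symmetricN|by rewrite normrN].
rewrite !ger0_norm// => Kp Kq ab1.
have [ab0|ab0] := eqVneq (a + b) 0.
  have [-> ->] : a = 0 /\ b = 0 by lra.
  by rewrite !scale0r addr0 -(scale0r p); exact: symmetric_convex_scale.
have ab_gt0 : 0 < a + b by rewrite lt_neqAle eq_sym ab0 addr_ge0.
have -> : a *: p + b *: q =
    (a + b) *: ((a / (a + b)) *: p + (1 - a / (a + b)) *: q).
  by apply/rowP => i; rewrite !mxE; field.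
apply: symmetric_convex_scale => //; last exact: ltW.
by apply: vK => //; rewrite ?divr_ge0 ?ler_pdivrMr ?mul1r ?lerDl// ltW.
Qed.

(* The rhombus with diagonals [p] and [q] contains a disc of radius
   [|q| / sqrt 2], as [q] is the shorter diagonal. *)
Lemma orthogonal_section_bound K p q : compact K -> Defs.convex_set K ->
  centrally_symmetric K -> K p -> K q -> dot p q = 0 ->
  dot q q <= dot p p -> dot q q <= 2 * r2 K ^+ 2.
Proof.
move=> cK vK sK Kp Kq pq qp.
have [->|q0] := eqVneq q 0.
  by rewrite {1}dotE !mxE !mul0r !addr0 mulr_ge0// sqr_ge0.
have Q0 := dot_gt0 q0; have P0 : 0 < dot p p := lt_le_trans Q0 qp.
have p0 : p != 0.
  by apply: contraTneq P0 => ->; rewrite dotE !mxE !mul0r !addr0 ltxx.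
pose m := Num.sqrt (dot p p); pose n := Num.sqrt (dot q q).
have m0 : 0 < m by rewrite sqrtr_gt0.
have n0 : 0 < n by rewrite sqrtr_gt0.
have nn : n ^+ 2 = dot q q by rewrite sqr_sqrtr ?ltW.
have mn : n <= m by apply: ler_wsqrtr.
have sq2 : Num.sqrt 2 ^+ 2 = 2 :> R by rewrite sqr_sqrtr.
have sq2_gt0 : 0 < Num.sqrt 2 :> R by rewrite sqrtr_gt0.
have uv : orthonormal2 (m^-1 *: p) (n^-1 *: q).
  split; [exact: normalize|split; [exact: normalize|]].
  by rewrite !dot_linear pq !mulr0.
have : n / Num.sqrt 2 <= r2 K.
  apply: (disc_le_r2 cK uv); first by rewrite divr_ge0// ltW.
  move=> _ [a _ [b _ <-]]; rewrite enorm_le ?divr_ge0 ?(ltW n0) ?(ltW sq2_gt0)//.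
  rewrite !scalerA => h; apply: symmetric_convex_rhombus => //.
  have {}h : 2 * (a ^+ 2 + b ^+ 2) <= n ^+ 2.
    move: h; rewrite !dot_linear (dotC q p) pq !mulr0 !addr0 add0r.
    rewrite -nn -[dot p p](sqr_sqrtr (ltW P0)) -/m.
    have -> : a / m * (a / m * m ^+ 2) = a ^+ 2 by field; rewrite gt_eqF.
    have -> : b / n * (b / n * n ^+ 2) = b ^+ 2 by field; rewrite gt_eqF.
    by rewrite expr_div_n sq2 ler_pdivlMr// mulrC.
  (* As [n <= m], the weights sum to at most [(|a| + |b|) / n], and
     [(|a| + |b|)^2 <= 2 (a^2 + b^2) <= n^2]. *)
  rewrite !normrM !normfV (gtr0_norm m0) (gtr0_norm n0).
  have am : `|a| / m <= `|a| / n by rewrite ler_wpM2l// lef_pV2.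
  apply: (@le_trans _ _ ((`|a| + `|b|) / n)); first by rewrite mulrDl lerD2r.
  rewrite ler_pdivrMr// mul1r -(ler_pXn2r (n := 2))// ?nnegrE ?addr_ge0// ?(ltW n0)//.
  apply: le_trans h; rewrite -(real_normK (num_real a)) -(real_normK (num_real b)).
  by have := sqr_ge0 (`|a| - `|b|); lra.
move=> h; have : (n / Num.sqrt 2) ^+ 2 <= r2 K ^+ 2.
  by apply: lerXn2r => //; rewrite ?nnegrE; [rewrite divr_ge0// ltW|
     apply: le_trans h; rewrite divr_ge0// ltW].
by rewrite expr_div_n sq2 nn ler_pdivrMr// mulrC.
Qed.

End Radii.

(** Carries the bounds of a minimising sequence over to a cluster point without extracting a
    subsequence: otherwise a tail of [u] would avoid the neighbourhood where [f] exceeds [c + e]. *)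
Lemma cluster_seq_le (R : realType) (T : topologicalType) (f : T -> R)
    (u : nat -> T) (x : T) (c : R) :
  continuous f -> cluster (u @ \oo) x ->
  (forall n, f (u n) <= c + n.+1%:R^-1) -> f x <= c.
Proof.
move=> cf clx fu; rewrite leNgt; apply/negP => cfx.
pose e := (f x - c) / 2; have e0 : 0 < e by rewrite /e; lra.
have hce : c + e < f x by rewrite /e; lra.
have [] := clx [set u n | n in [set n | n.+1%:R^-1 < e]] [set y | c + e < f y].
- apply: filterS (near_infty_natSinv_lt (PosNum e0)) => n /= ne.
  by exists n.
- by apply: (cvgr_gt (f x)) hce; exact: cf.
move=> _ [[n /= ne <-]] /=; rewrite ltNge => /negP; apply.
by apply: le_trans (fu n) _; rewrite lerD2l ltW.
Qed.

(** * Oblique projections onto the plane orthogonal to [p], and the optimal axis *)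

Section Shear.
Variable R : realType.
Implicit Types (K : set 'rV[R]_3) (u v w x y p q d : 'rV[R]_3) (g s t : R).

(** The angle between [x] and [y] is at least 90 and below 120 degrees, so a vector of the plane
    outside the open half-plane around [x + y] makes more than 120 degrees with one of them. Here
    [g] is a squared length. *)
Lemma acute_sum p x y w g : p != 0 ->
  dot x p = 0 -> dot y p = 0 -> dot w p = 0 ->
  dot x x = g -> dot y y = g -> dot w w = g -> 0 < g ->
  dot x y <= 0 -> - g < 2 * dot x y -> - g < 2 * dot x w -> - g < 2 * dot y w ->
  0 < dot w (x + y).
Proof.
move=> p0 xp yp wp xx yy ww g0 xy0 xy xw yw.
have := gram3_eq0 p0 xp yp wp; rewrite xx yy ww dotDr (dotC w x) (dotC w y).
move: (dot x y) (dot x w) (dot y w) xy0 xy xw yw => c a b c0 hc ha hb gram.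
rewrite ltNge; apply/negP => ab0.
(* The Gram relation says that [w] expands along the orthogonal vectors [x + y] and [x - y], of
   squared lengths [2 (g + c)] and [2 (g - c)]. *)
have e : 2 * (g * (g - c) * (g + c)) =
    (a + b) ^+ 2 * (g - c) + (a - b) ^+ 2 * (g + c) by lra.
have h1 : (a + b) ^+ 2 + (a - b) ^+ 2 < g ^+ 2.
  have -> : (a + b) ^+ 2 + (a - b) ^+ 2 = 2 * a ^+ 2 + 2 * b ^+ 2 by ring.
  have [le_ba|lt_ab] := leP b a; nra.
have h2 : (a - b) ^+ 2 * (g + c) <= (a - b) ^+ 2 * (g - c).
  by apply: ler_wpM2l; [exact: sqr_ge0|lra].
have h3 : ((a + b) ^+ 2 + (a - b) ^+ 2) * (g - c) < g ^+ 2 * (g - c).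
  by rewrite ltr_pM2r//; lra.
have : g * (g - c) * (g + 2 * c) < 0 by lra.
by rewrite ltNge => /negP; apply; rewrite !mulr_ge0//; lra.
Qed.

(** Normalised so that [p] itself has height 1. *)
Definition height p y : R := dot y p / dot p p.

(* For [dot w p = dot p p] this is the projection onto [p^perp] along [w]. *)
Definition shear p w y := y - height p y *: w.

Definition shear_sq p w y := dot (shear p w y) (shear p w y).

Lemma heightN p y : height p (- y) = - height p y.
Proof. by rewrite /height dotNl mulNr. Qed.

Lemma shearN p w y : shear p w (- y) = - shear p w y.
Proof. by rewrite /shear heightN scaleNr opprD opprK. Qed.

Lemma height_dot p y : p != 0 -> height p y * dot p p = dot y p.
Proof. by move=> /dot_gt0 p0; rewrite /height divfK ?gt_eqF. Qed.

Lemma dot_shear p w y : p != 0 -> dot w p = dot p p -> dot (shear p w y) p = 0.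
Proof.
by move=> p0 wp; rewrite /shear !dot_linear wp height_dot// subrr.
Qed.

Lemma height_sqr_le1 p y : p != 0 -> dot y y <= dot p p -> height p y ^+ 2 <= 1.
Proof.
move=> p0 yp; have P0 := dot_gt0 p0.
have := dot_ge0 (y - height p y *: p).
rewrite !dot_linear (dotC p y) -(height_dot y p0) => h.
rewrite -(ler_pM2r P0) mul1r; lra.
Qed.

(** The linear term in [t] shows that tilting the axis towards [d] shortens the image of [y] to
    first order when [height p y * dot (shear p w y) d] is positive. *)
Lemma shear_sqD p w d y t : shear_sq p (w + t *: d) y =
  shear_sq p w y - 2 * t * (height p y * dot (shear p w y) d)
  + t ^+ 2 * height p y ^+ 2 * dot d d.
Proof.
have -> : shear_sq p (w + t *: d) y =
    dot (shear p w y - (t * height p y) *: d) (shear p w y - (t * height p y) *: d).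
  by rewrite /shear_sq /shear; congr dot; apply/rowP => i; rewrite !mxE; ring.
rewrite /shear_sq; move: (shear p w y) => v.
by rewrite !dot_linear (dotC d v); ring.
Qed.

Section Continuity.
Variable T : topologicalType.
Implicit Types f h : T -> 'rV[R]_3.

Lemma continuous_dotl p f : continuous f -> continuous (fun z => dot (f z) p).
Proof.
by move=> cf; apply: (continuous_dot (g := fun=> p)) => //; exact: cst_continuous.
Qed.

Lemma continuous_height p f :
  continuous f -> continuous (fun z => height p (f z)).
Proof.
move=> cf z; apply: cvgM; last exact: cvg_cst.
exact: continuous_dotl.
Qed.

Lemma continuous_shear p f h : continuous f -> continuous h ->
  continuous (fun z => shear p (f z) (h z)).
Proof.
move=> cf ch z; apply: cvgB; first exact: ch.
by apply: cvgZ; [exact: continuous_height|exact: cf].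
Qed.

Lemma continuous_shear_sq p f h : continuous f -> continuous h ->
  continuous (fun z => shear_sq p (f z) (h z)).
Proof. by move=> cf ch; apply: continuous_dot; exact: continuous_shear. Qed.

Lemma continuous_descent p w d g f : continuous f ->
  continuous (fun z => Num.max (g - shear_sq p w (f z))
                               (height p (f z) * dot (shear p w (f z)) d)).
Proof.
move=> cf; have cw : continuous (fun _ : T => w) by exact: cst_continuous.
apply: max_fun_continuous => z.
  apply: cvgB; first exact: cvg_cst.
  by apply: (continuous_shear_sq (f := fun=> w)).
apply: cvgM; first exact: continuous_height.
by apply: continuous_dotl; apply: (continuous_shear (f := fun=> w)).
Qed.

End Continuity.

(* The segment from [y] to [- y'] crosses [p^perp] at a point of [K]. *)
Lemma contact_dot_ge K p w y y' g s : Defs.convex_set K -> centrally_symmetric K ->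
  p != 0 -> (forall q, K q -> dot q p = 0 -> dot q q <= s) -> s <= g ->
  K y -> K y' -> 0 < height p y -> 0 < height p y' ->
  shear_sq p w y = g -> shear_sq p w y' = g ->
  g - 2 * s <= dot (shear p w y) (shear p w y').
Proof.
move=> vK sK p0 Ks sg Ky Ky' z0 z0' vv vv'.
have zp := height_dot y p0; have zp' := height_dot y' p0.
move: vv vv' zp zp'; rewrite /shear_sq /shear.
move: (height p y) (height p y') z0 z0' => z z' z0 z0'.
set v := y - z *: w; set v' := y' - z' *: w => vv vv' zp zp'.
have zz0 : z + z' != 0 by rewrite gt_eqF// addr_gt0.
(* The weights make the heights [z] and [- z'] cancel. *)
pose q := (z' / (z + z')) *: y + (1 - z' / (z + z')) *: - y'.
have qE : (z + z') *: q = z' *: v - z *: v'.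
  by apply/rowP => i; rewrite !mxE; field.
have Kq : K q.
  apply: vK => //; first exact: symmetricN.
    by rewrite divr_ge0// ltW// addr_gt0.
  by rewrite ler_pdivrMr ?addr_gt0// mul1r lerDr ltW.
have qp : dot q p = 0.
  by rewrite /q !dot_linear -zp -zp'; field.
have := Ks q Kq qp; rewrite -(ler_pM2l (x := (z + z') ^+ 2)); last first.
  by rewrite exprn_gt0// addr_gt0.
have -> : (z + z') ^+ 2 * dot q q = dot ((z + z') *: q) ((z + z') *: q).
  by rewrite !dot_linear; ring.
have sqr_sub a b : dot (z' *: a - z *: b) (z' *: a - z *: b) =
    z' ^+ 2 * dot a a + z ^+ 2 * dot b b - 2 * (z * z') * dot a b.
  by rewrite !dot_linear (dotC b a); ring.
rewrite qE sqr_sub vv vv' => h.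
have zz : 0 < 2 * (z * z') by rewrite !mulr_gt0.
rewrite -(ler_pM2l zz).
(* Exactly the slack between [h] and the goal scaled by [2 z z']. *)
have : 0 <= (z - z') ^+ 2 * (g - s) by rewrite mulr_ge0 ?sqr_ge0// subr_ge0.
lra.
Qed.

(** With [s] and [g] squared lengths, [4 s < 3 g] gives [g - 2 s > - g / 2]: the images of contact
    points make angles below 120 degrees with one another. They thus fill an open half-plane at
    most, and [d] points into it. *)
Lemma descent_direction K p w g s : Defs.convex_set K -> centrally_symmetric K ->
  p != 0 -> dot w p = dot p p -> 0 <= s -> 4 * s < 3 * g ->
  (forall q, K q -> dot q p = 0 -> dot q q <= s) ->
  exists2 d, dot d p = 0 &
    forall y, K y -> shear_sq p w y = g -> 0 < height p y * dot (shear p w y) d.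
Proof.
move=> vK sK p0 wp s0 sg Ks.
pose contact y := [/\ K y, 0 < height p y & shear_sq p w y = g].
have obtuse y y' : contact y -> contact y' ->
    - g < 2 * dot (shear p w y) (shear p w y').
  move=> [Ky z0 vv] [Ky' z0' vv'].
  have sg' : s <= g by lra.
  have := contact_dot_ge vK sK p0 Ks sg' Ky Ky' z0 z0' vv vv'; lra.
(* Negative heights reduce to positive ones by symmetry; at height zero the squared length is at
   most [s < g]. *)
suff [d dp hd] : exists2 d, dot d p = 0 &
    forall y, contact y -> 0 < dot (shear p w y) d.
  exists d => // y Ky vv.
  have [z0|z0|z0] := ltgtP (height p y) 0.
  - have : 0 < dot (shear p w (- y)) d.
      apply: hd; split; [exact: symmetricN|by rewrite heightN oppr_gt0|].
      by rewrite /shear_sq shearN dotNl dotNr opprK.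
    by rewrite shearN dotNl oppr_gt0 nmulr_rgt0.
  - by rewrite mulr_gt0//; apply: hd.
  - have yp : dot y p = 0 by rewrite -height_dot// z0 mul0r.
    have := Ks y Ky yp; move: vv; rewrite /shear_sq /shear z0 scale0r subr0; lra.
have [[y1 [y2 [c1 c2 h12]]]|no_obtuse] := pselect (exists y1 y2,
    [/\ contact y1, contact y2 & dot (shear p w y1) (shear p w y2) <= 0]).
  exists (shear p w y1 + shear p w y2).
    by rewrite dotDl !dot_shear// addr0.
  move=> y cy; case: (c1) (c2) (cy) => [_ _ v1] [_ _ v2] [_ _ vy].
  apply: (acute_sum p0 _ _ _ v1 v2 vy) => //; try exact: dot_shear; try exact: obtuse.
  lra.
have [[y1 c1]|no_contact] := pselect (exists y1, contact y1).
  exists (shear p w y1); first exact: dot_shear.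
  move=> y cy; rewrite ltNge; apply/negP => h.
  by apply: no_obtuse; exists y, y1.
exists 0; first by rewrite dotE !mxE !mul0r !addr0.
by move=> y cy; case: no_contact; exists y.
Qed.

(** Compactness turns the pointwise descent at contact points into one step [e] that works for all
    of [K]. *)
Lemma shear_improve K p w g s : compact K -> Defs.convex_set K ->
  centrally_symmetric K -> K p -> p != 0 -> dot w p = dot p p ->
  0 <= s -> 4 * s < 3 * g ->
  (forall q, K q -> dot q p = 0 -> dot q q <= s) ->
  (forall y, K y -> dot y y <= dot p p) ->
  (forall y, K y -> shear_sq p w y <= g) ->
  exists w' g', [/\ dot w' p = dot p p, g' < g &
    forall y, K y -> shear_sq p w' y <= g'].
Proof.
move=> cK vK sK Kp p0 wp s0 sg Ks pmax Kg.
have [d dp hd] := descent_direction vK sK p0 wp s0 sg Ks.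
pose phi y := height p y * dot (shear p w y) d.
(* Positive on [K]: either [y] is below level [g], or it is a contact point and the tilt gains to
   first order. Its minimum [del] makes this uniform. *)
pose f y := Num.max (g - shear_sq p w y) (phi y).
have cf : continuous f.
  by apply: (continuous_descent (f := id)) => y; exact: cvg_id.
have [c /[!inE] Kc cmin] :=
  EVT_min_rV (ex_intro _ p Kp) cK (continuous_subspaceT cf).
pose del := f c; have del0 : 0 < del.
  rewrite /del /f /= lt_max subr_gt0 lt_neqAle Kg// andbT.
  by have [/hd/= -> //|//] := eqVneq; rewrite ?orbT.
have dd := dot_ge0 d.
(* Large enough that [e * B = del / 2] yields [e <= 1] and [e |d|^2 <= del], and bounds the cost of
   the tilt away from contact. *)
pose B := g + 2 * dot d d + del + 1.
have B0 : 0 < B by rewrite /B; lra.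
pose e := del / (2 * B).
have e0 : 0 < e by rewrite divr_gt0// mulr_gt0.
have eB : e * B = del / 2 by rewrite /e; field; rewrite gt_eqF.
exists (w + e *: d), (g - e * del); split.
- by rewrite dotDl dotZl dp mulr0 addr0.
- by rewrite gtrBl mulr_gt0.
move=> y Ky; rewrite shear_sqD -/(phi y).
have z1 := height_sqr_le1 p0 (pmax y Ky).
have zd : height p y ^+ 2 * dot d d <= dot d d by rewrite ler_piMl.
have ezd : e ^+ 2 * height p y ^+ 2 * dot d d <= e * (e * dot d d).
  by rewrite -mulrA expr2 -mulrA !ler_pM2l.
have eB1 : e * g + e * dot d d * 2 + e * del + e = del / 2.
  by rewrite -eB /B; ring.
have eg0 : 0 <= e * g by rewrite mulr_ge0 ?ltW//; lra.
have ed0 : 0 <= e * dot d d by rewrite mulr_ge0// ltW.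
have edel0 : 0 < e * del by rewrite mulr_gt0.
have e1 : e <= 1.
  rewrite -(ler_pM2r del0) mul1r; lra.
have ee : e * (e * dot d d) <= e * dot d d by rewrite ler_piMl.
have : del <= f y by apply: cmin; rewrite inE.
(* Either the gap [del] absorbs the cost of the tilt, or the gain [2 e del] beats the quadratic
   term, at most [e del]. *)
rewrite /f /= le_max => /orP[hF|hphi].
  have phi_ge : - (2 * phi y) <= g + dot d d.
    have := Kg y Ky; have := dot_ge0 (shear p w y + height p y *: d).
    rewrite /phi /shear_sq; move: (shear p w y) => v.
    rewrite !dot_linear (dotC d v); lra.
  have := ler_wpM2l (ltW e0) phi_ge; lra.
have := ler_wpM2l (ltW e0) hphi.
have : e * (e * dot d d) <= e * del by rewrite ler_pM2l//; lra.
have := Kg y Ky; lra.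
Qed.

(** As [p] has height 1, a level bound at [p] bounds [|p - w|]; near-optimal axes stay in a compact
    box and have a cluster point. *)
Lemma shear_minimizer K p : K p -> p != 0 ->
  (forall y, K y -> dot y y <= dot p p) ->
  exists w g, [/\ dot w p = dot p p, forall y, K y -> shear_sq p w y <= g &
    forall w' g', dot w' p = dot p p ->
      (forall y, K y -> shear_sq p w' y <= g') -> g <= g'].
Proof.
move=> Kp p0 pmax; have P0 := dot_gt0 p0.
have hp : height p p = 1 by rewrite /height divff ?gt_eqF.
pose S := [set g : R | exists2 w, dot w p = dot p p &
  forall y, K y -> shear_sq p w y <= g].
have lS : has_lbound S.
  by exists 0 => g [w _ /(_ p Kp)]; apply: le_trans; exact: dot_ge0.
have S0 : S !=set0.
  (* Orthogonal projection along [p] does not lengthen vectors. *)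
  exists (dot p p), p => // y Ky; apply: le_trans (pmax y Ky).
  rewrite /shear_sq /shear !dot_linear (dotC p y) -(height_dot y p0).
  have : 0 <= height p y ^+ 2 * dot p p by rewrite mulr_ge0 ?sqr_ge0// ltW.
  lra.
have /choice[w_ hw] : forall n : nat, exists w, dot w p = dot p p /\
    forall y, K y -> shear_sq p w y <= inf S + n.+1%:R^-1.
  move=> n; have [|g [w wp hg] /ltW gS] := @inf_adherent _ S n.+1%:R^-1 _ (conj S0 lS).
    by rewrite invr_gt0.
  by exists w; split=> // y Ky; exact: le_trans (hg y Ky) gS.
(* Ensures [|p - w_ n|^2 <= M] and [1 <= M], hence coordinatewise distance at most [M]. *)
pose M := inf S + 2.
pose I (i : 'I_3) := `[p 0 i - M, p 0 i + M]%classic.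
have box : compact [set w : 'rV[R]_3 | forall i, I i (w 0 i)].
  by apply: (rV_compact (A := I)) => i; exact: segment_compact.
have [w [_ clw]] : [set w : 'rV[R]_3 | forall i, I i (w 0 i)]
    `&` cluster (w_ @ \oo) !=set0.
  apply: box; exists 0%N => // n _ i.
  have [_ /(_ p Kp)] := hw n; rewrite /shear_sq /shear hp scale1r => h.
  have n1 : n.+1%:R^-1 <= 1 :> R by rewrite invf_le1// ler1n.
  have : (p 0 i - w_ n 0 i) ^+ 2 <= dot (p - w_ n) (p - w_ n).
    rewrite /dot (bigD1 i)//= !mxE -expr2 lerDl sumr_ge0// => j _.
    by rewrite -expr2 sqr_ge0.
  have M1 : 1 <= M.
    have : 0 <= inf S.
      by apply: lb_le_inf => // g [v _ /(_ p Kp)]; apply: le_trans; exact: dot_ge0.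
    rewrite /M; lra.
  move=> h2; have : `|p 0 i - w_ n 0 i| <= M.
    rewrite -(ler_pXn2r (n := 2)) ?nnegrE ?real_normK ?num_real//; last lra.
    apply: le_trans h2 (le_trans h _).
    apply: (@le_trans _ _ M); last by rewrite expr2 ler_peMl//; lra.
    by rewrite /M lerD2l (le_trans n1)// ler1n.
  by rewrite ler_distlC /I /= in_itv.
have cid : continuous (fun v : 'rV[R]_3 => v) by move=> v; exact: cvg_id.
have ninv (n : nat) : 0 <= n.+1%:R^-1 :> R by rewrite invr_ge0.
exists w, (inf S); split.
(* [cluster_seq_le] passes upper bounds only, so the equality is split in two, the second with
   [- p]. *)
- apply/eqP; rewrite eq_le; apply/andP; split.
    apply: (cluster_seq_le (continuous_dotl (p := p) cid) clw) => n.
    by rewrite (hw n).1 lerDl.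
  rewrite -lerN2 -!dotNr.
  apply: (cluster_seq_le (continuous_dotl (p := - p) cid) clw) => n.
  by rewrite !dotNr (hw n).1 lerDl.
- move=> y Ky.
  have cs : continuous (fun v : 'rV[R]_3 => shear_sq p v y).
    by apply: (continuous_shear_sq (h := fun=> y)) => //; exact: cst_continuous.
  by apply: (cluster_seq_le cs clw) => n; exact: (hw n).2.
- by move=> w' g' w'p hg'; apply: ge_inf => //; exists w'.
Qed.

Lemma oblique_cylinder K p s : compact K -> Defs.convex_set K ->
  centrally_symmetric K -> K p -> p != 0 -> 0 <= s ->
  (forall y, K y -> dot y y <= dot p p) ->
  (forall q, K q -> dot q p = 0 -> dot q q <= s) ->
  exists2 w, dot w p = dot p p & forall y, K y -> 3 * shear_sq p w y <= 4 * s.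
Proof.
move=> cK vK sK Kp p0 s0 pmax Ks.
have [w [g [wp hw gmin]]] := shear_minimizer Kp p0 pmax.
exists w => // y Ky.
have [sg|sg] := ltP (4 * s) (3 * g); last by have := hw y Ky; lra.
have [w' [g' [w'p g'g hw']]] :=
  shear_improve cK vK sK Kp p0 wp s0 sg Ks pmax hw.
by have := gmin w' g' w'p hw'; rewrite leNgt g'g.
Qed.

End Shear.

Theorem theorem1p1 (R : realType) (K : set 'rV[R]_3) :
  convex_body K -> centrally_symmetric K -> 0 < r2 K ->
  R2 K / r2 K <= 2 * Num.sqrt 2 / Num.sqrt 3.
Proof.
move=> [cK vK] sK r0; have K0 := r2_gt0_nonempty r0.
have [p Kp pmax] := farthest_point cK K0.
have sq3 : 0 < Num.sqrt 3 :> R by rewrite sqrtr_gt0.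
rewrite ler_pdivrMr//; set c := 2 * Num.sqrt 2 / Num.sqrt 3.
have c0 : 0 <= c by rewrite divr_ge0// ?mulr_ge0 ?sqrtr_ge0.
have c2 : 3 * (c * r2 K) ^+ 2 = 4 * (2 * r2 K ^+ 2).
  by rewrite /c exprMn expr_div_n exprMn !sqr_sqrtr//; field.
have [w w0 hw] : exists2 w, w != 0 & forall y, K y -> exists t,
    dot (y - t *: w) (y - t *: w) <= (c * r2 K) ^+ 2.
  (* If the farthest point is [0], all of [K] is [0] and any axis does. *)
  have [p0|p0] := eqVneq p 0.
    exists (vec3 1 0 0).
      by apply/eqP => /rowP/(_ 0); rewrite !mxE; apply/eqP; rewrite oner_eq0.
    move=> y /pmax; rewrite p0 => y0; exists 0; rewrite scale0r subr0.
    apply: le_trans y0 _; rewrite dotE !mxE !mul0r !addr0; exact: sqr_ge0.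
  (* The parameter [s] is the squared radius of the section; [c2] matches [4 s / 3] with the squared
     target radius. *)
  have [|q Kq qp|w wp hw] := oblique_cylinder (s := 2 * r2 K ^+ 2) cK vK sK Kp p0 _ pmax.
  - by rewrite mulr_ge0// sqr_ge0.
  - by apply: (orthogonal_section_bound cK vK sK Kp Kq); rewrite ?pmax// dotC.
  exists w.
    apply: contraTneq (dot_gt0 p0) => w0; rewrite -wp w0.
    by rewrite dotE !mxE !mul0r !addr0 ltxx.
  by move=> y /hw; exists (height p y); rewrite -(ler_pM2l (x := 3))// c2.
by apply: (R2_le_cylinder K0 w0) => //; rewrite mulr_ge0// ltW.
Qed.
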